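(* Let $n\ge2$, let $\Omega\subset\mathbb{R}^n$ be a domain and let $u\in C^3(\Omega)$. Let $a,b:[0,\infty)\to(0,\infty)$ be $C^1$-functions, and define, for $t\ge0$, $$\vartheta_a(t):=\frac{ta'(t)}{a(t)},\qquad \vartheta_b(t):=\frac{tb'(t)}{b(t)},\qquad \theta(t):=\frac{1+\vartheta_a(t)}{1+\vartheta_b(t)},$$ and $i_a:=\inf_{t\ge0}\vartheta_a(t)$, $s_a:=\sup_{t\ge0}\vartheta_a(t)$, $i_b:=\inf_{t\ge0}\vartheta_b(t)$, $s_b:=\sup_{t\ge0}\vartheta_b(t)$, $i_\theta:=\inf_{t\ge0}\theta(t)$, $s_\theta:=\sup_{t\ge0}\theta(t)$. Assume that $$-1<i_a\le s_a<\infty\quad\text{and}\quad -1<i_b\le s_b<\infty,$$ and that $$0<i_\theta\le s_\theta<\frac{2(n-1)}{n-2}.$$ Set $V_a:=a(|Du|)Du$ and $V_b:=b(|Du|)Du$. Then there exist constants $c=c(n,i_\theta,s_\theta,i_b,s_b)>0$ and $C=C(n,i_\theta,s_\theta)>0$ such that $$c|DV_b|^2\le\operatorname{div}\big((DV_b-\operatorname{tr}(DV_b)I)V_b\big)+C\Big(\frac{b(|Du|)}{a(|Du|)}\Big)^2\big(\operatorname{div}(V_a)\big)^2$$ everywhere in $\Omega$.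
   Context: For $n=2$ the quantity $\frac{2(n-1)}{n-2}$ is understood as $+\infty$. $Du$ is the gradient of $u$; for a vector field $X$, $DX=(\partial X_i/\partial x_j)_{i,j=1}^n$ is its Jacobian matrix; $|M|=(\sum_{i,j}M_{ij}^2)^{1/2}$ is the Hilbert–Schmidt norm of a matrix $M$, $\operatorname{tr}$ is the trace and $I$ the $n\times n$ identity matrix. The notation $c=c(\dots)$ means that the constant depends only on the listed quantities. *)

(* Defs.v *)
From HB Require Import structures.
From mathcomp Require Import all_boot all_order all_algebra.
From mathcomp Require Import all_classical all_reals all_analysis.

Set Implicit Arguments.
Unset Strict Implicit.
Unset Printing Implicit Defensive.

Import Order.TTheory GRing.Theory Num.Theory.
Import numFieldNormedType.Exports.

Local Open Scope classical_set_scope.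
Local Open Scope ring_scope.

(* R^n is the space of column vectors.  The library's norm on matrices is the
   sup norm: it is only used here through its topology, and the Euclidean and
   Hilbert-Schmidt norms are [hsnorm]. *)
Definition hsnorm (R : realType) (m n : nat) (M : 'M[R]_(m, n)) : R :=
  Num.sqrt (\sum_i \sum_j M i j ^+ 2).

Definition domain (R : realType) (n : nat) (Omega : set 'cV[R]_n) : Prop :=
  [/\ open Omega, Omega !=set0 & connected Omega].

Definition partial (R : realType) (n : nat) (i : 'I_n) (f : 'cV[R]_n -> R) :
    'cV[R]_n -> R :=
  fun x => 'D_(delta_mx i ord0) f x.

Fixpoint Ck (R : realType) (n k : nat) (Omega : set 'cV[R]_n)
    (f : 'cV[R]_n -> R) : Prop :=
  (forall x, Omega x -> {for x, continuous f}) /\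
  match k with
  | 0%N => True
  | k'.+1 => forall i : 'I_n,
      (forall x, Omega x -> derivable f x (delta_mx i ord0)) /\
      Ck k' Omega (partial i f)
  end.

Definition grad (R : realType) (n : nat) (f : 'cV[R]_n -> R) (x : 'cV[R]_n) :
    'cV[R]_n :=
  \col_i partial i f x.

(* Row index = component, column index = variable; this is the transpose of the
   library's ['J], which acts on row vectors. *)
Definition jac (R : realType) (n : nat) (X : 'cV[R]_n -> 'cV[R]_n)
    (x : 'cV[R]_n) : 'M[R]_n :=
  \matrix_(i, j) partial j (fun y => X y i ord0) x.

Definition divergence (R : realType) (n : nat) (X : 'cV[R]_n -> 'cV[R]_n)
    (x : 'cV[R]_n) : R :=
  \sum_i partial i (fun y => X y i ord0) x.

(* Functions on [0, +oo[ are represented by total functions f : R -> R whose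
   values at negative arguments are irrelevant: the derivative is the limit of
   difference quotients taken within [0, +oo[ (right derivative at 0). *)
Definition diffquot (R : realType) (f : R -> R) (t s : R) : R :=
  (f s - f t) / (s - t).

Definition derive_ge0 (R : realType) (f : R -> R) (t : R) : R :=
  lim (diffquot f t s @[s --> within `[0, +oo[ t^']).

Definition C1_ge0 (R : realType) (f : R -> R) : Prop :=
  (forall t, 0 <= t -> cvg (diffquot f t s @[s --> within `[0, +oo[ t^'])) /\
  {within `[0, +oo[, continuous (derive_ge0 f)}.

Definition vartheta (R : realType) (a : R -> R) (t : R) : R :=
  t * derive_ge0 a t / a t.

Definition theta (R : realType) (a b : R -> R) (t : R) : R :=
  (1 + vartheta a t) / (1 + vartheta b t).

Definition inf_ge0 (R : realType) (f : R -> R) : \bar R :=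
  ereal_inf [set (f t)%:E | t in `[0, +oo[].

Definition sup_ge0 (R : realType) (f : R -> R) : \bar R :=
  ereal_sup [set (f t)%:E | t in `[0, +oo[].

Definition theta_bound (R : realType) (n : nat) : \bar R :=
  if n == 2%N then +oo%E else (2 * (n%:R - 1) / (n%:R - 2))%:E.

Definition Vfield (R : realType) (n : nat) (a : R -> R) (u : 'cV[R]_n -> R)
    (x : 'cV[R]_n) : 'cV[R]_n :=
  a (hsnorm (grad u x)) *: grad u x.

(* Main.v *)
Require Import Defs.
From HB Require Import structures.
From mathcomp Require Import all_boot all_order all_algebra.
From mathcomp Require Import all_classical all_reals all_analysis.
From mathcomp Require Import ring lra.

Set Implicit Arguments.
Unset Strict Implicit.
Unset Printing Implicit Defensive.

Import Order.TTheory GRing.Theory Num.Theory.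
Import numFieldNormedType.Exports.

Local Open Scope classical_set_scope.
Local Open Scope ring_scope.

(* Write p = Du = t w with |w| = 1 and H for the Hessian of u.  In the field
   (DV_b - tr(DV_b) I) V_b all terms containing b' cancel, and what remains is
   b(t)^2 (H p - tr(H) p); by symmetry of the third derivatives its divergence
   is b^2 [|H|^2 - tr(H)^2 + 2 theta_b (|H w|^2 - tr(H) w.Hw)], while
   |DV_b|^2 = b^2 [|H|^2 + (2 theta_b + theta_b^2) |H w|^2] and
   div V_a = a [tr(H) + theta_a w.Hw].  So everything is a quadratic inequality
   in the numbers |H|^2, |H w|^2, w.Hw, tr(H), subject only to
   (w.Hw)^2 <= |H w|^2 and to tr(K)^2 <= (n-1) |K|^2 for the compression K of H
   to the hyperplane orthogonal to w.  Where Du = 0 the same formulas hold with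
   theta_a = theta_b = 0 and an arbitrary unit vector w. *)

(** * Constants and the quadratic inequality in scalar invariants *)

Definition coercivity_gap (R : realFieldType) (m it st : R) : R :=
  it * (2 - (m - 1) / m * st).

(** The term [2 / coercivity_gap m it st] pays for the cross term by AM-GM. The summand 2 pays for
    [- mu * f ^+ 2] and for the [f ^+ 2] left over from the left-hand side. *)
Definition const_C (R : realFieldType) (m it st : R) : R :=
  2 / coercivity_gap m it st + 2.

(** The entry 1/2 controls the [f] terms and the remainder of |H|^2. The second controls the
    coefficient of [p ^+ 2], and the third the tangential part [w2 - h ^+ 2] of H w. *)
Definition const_c (R : realFieldType) (m it st ib sb : R) : R :=
  Num.min (1 / 2) (Num.min
    (coercivity_gap m it st / (2 * (1 + 2 * st ^+ 2)))
    (2 * (1 + ib) / ((1 + sb) ^+ 2 + 1))).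

Section ScalarInequality.
Variable R : realFieldType.
Implicit Types m it st ib sb : R.

(** The gap is a lower bound of theta (2 - mu theta), mu = (m - 1) / m, over theta in [it, st]. With
    m = n - 1 the second hypothesis is s_theta < 2(n - 1)/(n - 2), and it is automatic for n = 2,
    where mu = 0. *)
Lemma coercivity_gap_gt0 m it st : 0 < it -> (m - 1) / m * st < 2 ->
  0 < coercivity_gap m it st.
Proof. by move=> it_gt0 st_lt; apply: mulr_gt0; rewrite ?subr_gt0. Qed.

Lemma const_C_gt0 m it st : 0 < it -> (m - 1) / m * st < 2 ->
  0 < const_C m it st.
Proof. by move=> *; rewrite addr_gt0// divr_gt0// coercivity_gap_gt0. Qed.

Lemma const_c_gt0 m it st ib sb :
  0 < it -> (m - 1) / m * st < 2 -> 0 < 1 + ib ->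
  0 < const_c m it st ib sb.
Proof.
move=> *; rewrite /const_c !lt_min; apply/and3P; split.
- lra.
- rewrite divr_gt0 ?coercivity_gap_gt0// mulr_gt0// ltr_pwDl//.
  by rewrite mulr_ge0// sqr_ge0.
- by apply: divr_gt0; [rewrite mulr_gt0|rewrite ltr_wpDl// sqr_ge0].
Qed.

(* For f = 0 the right-hand side is theta (2 - mu theta) p ^ 2 with
   mu = (m - 1) / m; the terms with f are absorbed by AM-GM and const_C. *)
Lemma quadratic_coercive m it st ib sb (th p k f : R) :
  1 <= m -> 0 < it -> (m - 1) / m * st < 2 -> 0 < 1 + ib ->
  it <= th -> th <= st -> k = f - th * p ->
  const_c m it st ib sb * (p ^+ 2 + k ^+ 2 / m) <=
    k ^+ 2 / m - 2 * p * k - k ^+ 2 + const_C m it st * f ^+ 2.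
Proof.
move=> m_ge1 it_gt0 st_lt ib_gt itth thst ->.
set c := const_c _ _ _ _ _; set C := const_C _ _ _.
have d_gt0 := coercivity_gap_gt0 it_gt0 st_lt.
have c_gt0 : 0 < c by exact: const_c_gt0.
have c_le : c <= 1 / 2 by rewrite /c /const_c ge_min lexx.
have c_le2 : c * (2 * (1 + 2 * st ^+ 2)) <= coercivity_gap m it st.
  rewrite -ler_pdivlMr; last by have := sqr_ge0 st; lra.
  by rewrite /c /const_c !ge_min lexx orbT.
have CE : C = 2 / coercivity_gap m it st + 2 by [].
move: d_gt0 c_le2 CE; set d := coercivity_gap _ _ _.
have m_gt0 : 0 < m by lra.
set mu := (m - 1) / m.
have mu_ge0 : 0 <= mu by rewrite divr_ge0 ?subr_ge0// ltW.
have mu_lt1 : mu <= 1 by rewrite ler_pdivrMr// mul1r gerBl.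
have muE : m^-1 = 1 - mu by rewrite /mu; field; rewrite gt_eqF.
have dle : d <= th * (2 - mu * th).
  rewrite /d /coercivity_gap -/mu.
  have : mu * th <= mu * st by rewrite ler_wpM2l.
  move: st_lt; rewrite -/mu; nra.
have muth : mu * th <= 2.
  have : mu * th <= mu * st by rewrite ler_wpM2l.
  move: st_lt; rewrite -/mu; lra.
have muth0 : 0 <= mu * th by rewrite mulr_ge0//; lra.
rewrite !muE.
have th_gt0 : 0 < th by lra.
move=> d_gt0 c_le2 CE.
set e := d^-1 in CE.
have e_gt0 : 0 < e by rewrite invr_gt0.
have de : d * e = 1 by rewrite mulfV// gt_eqF.
have -> : C = 2 * e + 2 by [].
clearbody e d mu.
have s1 : th ^+ 2 <= st ^+ 2 by rewrite ler_sqr ?nnegrE//; lra.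
(* AM-GM for the cross term, whose coefficient satisfies |mu theta - 1| <= 1 *)
have sq : 0 <= d / 2 * p ^+ 2 + 2 * (mu * th - 1) * p * f + 2 * e * f ^+ 2.
  have s2 : (mu * th - 1) ^+ 2 <= 1 by nra.
  have : 0 <= 2 * e * (d / 2 * p + (mu * th - 1) * f) ^+ 2.
    by rewrite mulr_ge0 ?sqr_ge0//; lra.
  have -> : 2 * e * (d / 2 * p + (mu * th - 1) * f) ^+ 2 =
    (d * e) * (d / 2 * p ^+ 2 + 2 * (mu * th - 1) * p * f)
       + 2 * e * (mu * th - 1) ^+ 2 * f ^+ 2 by field.
  rewrite de mul1r => h; apply: le_trans h _; rewrite lerD2l.
  by rewrite ler_wpM2r ?sqr_ge0// ler_piMr//; lra.
have s3 : (f - th * p) ^+ 2 <= 2 * f ^+ 2 + 2 * st ^+ 2 * p ^+ 2.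
  have : 0 <= (f + th * p) ^+ 2 := sqr_ge0 _.
  have : th ^+ 2 * p ^+ 2 <= st ^+ 2 * p ^+ 2 by rewrite ler_wpM2r ?sqr_ge0.
  lra.
(* By [s3] the bracket is at most (1 + 2 st^2) p^2 + 2 f^2; then [c_le2] and [c_le] bound the two
   coefficients separately. *)
have s4 : c * (p ^+ 2 + (f - th * p) ^+ 2 * (1 - mu)) <=
    d / 2 * p ^+ 2 + f ^+ 2.
  have : (f - th * p) ^+ 2 * (1 - mu) <= 2 * f ^+ 2 + 2 * st ^+ 2 * p ^+ 2.
    by apply: le_trans s3; rewrite ler_piMr ?sqr_ge0//; lra.
  rewrite -(lerD2l (p ^+ 2)) -(ler_pM2l c_gt0) => h.
  apply: le_trans h _.
  have : (c * (2 * (1 + 2 * st ^+ 2))) * p ^+ 2 <= d * p ^+ 2.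
    by rewrite ler_wpM2r ?sqr_ge0.
  have : c * f ^+ 2 <= 1 / 2 * f ^+ 2 by rewrite ler_wpM2r ?sqr_ge0.
  lra.
have s5 : d * p ^+ 2 <= th * (2 - mu * th) * p ^+ 2.
  by rewrite ler_wpM2r ?sqr_ge0.
have s6 : mu * f ^+ 2 <= f ^+ 2 by rewrite ler_piMl ?sqr_ge0.
apply: le_trans s4 _.
lra.
Qed.

(* In the application H2 = |H|^2, w2 = |H w|^2, h = w.Hw and tau = tr H. *)
Lemma invariants_ineq m it st ib sb (va vb h w2 H2 tau : R) :
  1 <= m -> 0 < it -> (m - 1) / m * st < 2 -> 0 < 1 + ib ->
  ib <= vb -> vb <= sb ->
  it <= (1 + va) / (1 + vb) -> (1 + va) / (1 + vb) <= st ->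
  h ^+ 2 <= w2 -> (tau - h) ^+ 2 <= m * (H2 - 2 * w2 + h ^+ 2) ->
  const_c m it st ib sb * (H2 + (2 * vb + vb ^+ 2) * w2) <=
    H2 - tau ^+ 2 + 2 * vb * (w2 - tau * h)
      + const_C m it st * (tau + va * h) ^+ 2.
Proof.
move=> m_ge1 it_gt0 st_lt ib_gt ibvb vbsb.
set th := (1 + va) / _ => itth thst hw kH.
have be_gt0 : 0 < 1 + vb by lra.
have vaE : va = th * (1 + vb) - 1 by rewrite /th; field; rewrite gt_eqF.
have m_gt0 : 0 < m by lra.
have c_gt0 := const_c_gt0 sb it_gt0 st_lt ib_gt.
have c_le : const_c m it st ib sb <= 1 / 2 by rewrite /const_c ge_min lexx.
have c_le3 : const_c m it st ib sb * ((1 + sb) ^+ 2 + 1) <= 2 * (1 + ib).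
  rewrite -ler_pdivlMr; last by rewrite ltr_wpDl// sqr_ge0.
  by rewrite /const_c !ge_min lexx !orbT.
(* For these values p = (1 + vb) h, k = tau - h, f = tau + va h, the relation k = f - th p is the
   definition of th. *)
have := @quadratic_coercive m it st ib sb th ((1 + vb) * h) (tau - h)
  (tau + va * h) m_ge1 it_gt0 st_lt ib_gt itth thst.
rewrite vaE => /(_ ltac:(ring)).
move: kH; rewrite mulrC -ler_pdivrMr//.
set r := (tau - h) ^+ 2 / m.
move: c_gt0 c_le c_le3.
set c := const_c _ _ _ _ _; set C := const_C _ _ _ => c_gt0 c_le c_le3 kH qc.
clearbody c C.
(* Both sides split into three parts: the quadratic form in p and k, a multiple of w2 - h^2 >= 0,
   and H2 - 2 w2 + h^2 - r >= 0. The parts are compared one by one, the last two in [bb] and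
   [rr]. *)
have bb : c * ((1 + vb) ^+ 2 + 1) * (w2 - h ^+ 2) <=
    2 * (1 + vb) * (w2 - h ^+ 2).
  rewrite ler_wpM2r ?subr_ge0//.
  apply: le_trans (_ : c * ((1 + sb) ^+ 2 + 1) <= _); last lra.
  rewrite ler_pM2l// lerD2r ler_sqr ?nnegrE; lra.
have rr : c * (H2 - 2 * w2 + h ^+ 2 - r) <= 1 * (H2 - 2 * w2 + h ^+ 2 - r).
  by rewrite ler_wpM2r ?subr_ge0//; lra.
lra.
Qed.

End ScalarInequality.

(** * Trace inequalities for a symmetric matrix and a unit vector *)

Section ProjectedHessian.
Variables (R : realFieldType) (n : nat).
Implicit Types (A : 'M[R]_n) (w : 'cV[R]_n).

Lemma mxtraceN m (A : 'M[R]_m) : \tr (- A) = - \tr A.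
Proof. exact: raddfN. Qed.

Lemma tr_mxsq_sum m p (A : 'M[R]_(m, p)) :
  \tr (A *m A^T) = \sum_i \sum_j A i j ^+ 2.
Proof.
by apply: eq_bigr => i _; rewrite mxE; apply: eq_bigr => j _; rewrite mxE expr2.
Qed.

Lemma tr_mxsq_ge0 m p (A : 'M[R]_(m, p)) : 0 <= \tr (A *m A^T).
Proof.
by rewrite tr_mxsq_sum; do 2![apply: sumr_ge0 => ? _]; exact: sqr_ge0.
Qed.

(* The right-hand side is |P A P|^2 for the orthogonal projector
   P = 1 - w w^T. *)
Lemma projected_norm_ge0 A w : A^T = A -> w^T *m w = 1%:M ->
  0 <= \tr (A *m A) - 2 * \tr (w^T *m A *m A *m w) + \tr (w^T *m A *m w) ^+ 2.
Proof.
move=> As wE.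
have hE : w^T *m A *m w = (\tr (w^T *m A *m w))%:M.
  by rewrite trace_mx11 -mx11_scalar.
set h := \tr (w^T *m A *m w) in hE *.
pose P := 1%:M - w *m w^T.
have Pt : P^T = P by rewrite /P linearB /= trmx1 trmx_mul trmxK.
have PP : P *m P = P.
  rewrite {1}/P mulmxBl mul1mx {2}/P mulmxBr mulmx1 -mulmxA (mulmxA w^T).
  by rewrite wE mul1mx subrr subr0.
have := tr_mxsq_ge0 (P *m A *m P).
(* Idempotency and cyclicity of the trace reduce |P A P|^2 to the trace of (A P)^2, which is then
   expanded. *)
have -> : (P *m A *m P) *m (P *m A *m P)^T = P *m (A *m P *m A *m P).
  by rewrite !trmx_mul Pt As !mulmxA -(mulmxA (P *m A)) PP.
rewrite mxtrace_mulC. rewrite -(mulmxA _ P P) PP.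
have -> : A *m P *m A *m P = (A *m P) *m (A *m P) by rewrite !mulmxA.
have -> : A *m P = A - A *m w *m w^T by rewrite mulmxBr mulmx1 mulmxA.
have -> : (A - A *m w *m w^T) *m (A - A *m w *m w^T) =
    A *m A - A *m (A *m w) *m w^T - (A *m w) *m (w^T *m A)
      + (A *m w) *m (w^T *m A *m w) *m w^T.
  by rewrite mulmxBr !mulmxBl !mulmxA opprD opprK addrACA addrA.
rewrite hE mul_mx_scalar -scalemxAl !(mxtraceD, mxtraceN, mxtraceZ).
rewrite [\tr (A *m (A *m w) *m w^T)]mxtrace_mulC.
rewrite [\tr (A *m w *m (w^T *m A))]mxtrace_mulC.
rewrite [\tr (A *m w *m w^T)]mxtrace_mulC !mulmxA -/h.
by rewrite -expr2 mulr_natl mulr2n opprD addrA.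
Qed.

(** Cauchy-Schwarz, obtained from |A w - h w|^2 >= 0 with h = w.Aw. *)
Lemma quadform_sqr_le A w : A^T = A -> w^T *m w = 1%:M ->
  \tr (w^T *m A *m w) ^+ 2 <= \tr (w^T *m A *m A *m w).
Proof.
move=> As wE; set h := \tr _.
have := tr_mxsq_ge0 (A *m w - h *: w); rewrite mxtrace_mulC.
have -> : (A *m w - h *: w)^T *m (A *m w - h *: w) =
    w^T *m A *m A *m w - h *: (w^T *m A *m w) - h *: (w^T *m A *m w)
    + (h ^+ 2) *: (w^T *m w).
  rewrite !linearB /= linearZ /= trmx_mul As !mulmxBl.
  rewrite -!scalemxAr -!scalemxAl !mulmxA opprD opprK.
  by rewrite addrA scalerA -expr2.
rewrite !(mxtraceD, mxtraceN, mxtraceZ) -/h wE mxtrace1; lra.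
Qed.

(* [projected_norm_ge0] for A - l I, minimised over l. *)
Lemma projected_trace_le A w : (1 < n)%N -> A^T = A -> w^T *m w = 1%:M ->
  (\tr A - \tr (w^T *m A *m w)) ^+ 2 <=
  (n%:R - 1) * (\tr (A *m A) - 2 * \tr (w^T *m A *m A *m w)
                + \tr (w^T *m A *m w) ^+ 2).
Proof.
move=> n_gt1 As wE.
set k := _ - _; set Q := _ + _ ^+ 2.
have m_gt0 : 0 < n%:R - 1 :> R by rewrite subr_gt0 ltr1n.
pose l := k / (n%:R - 1).
have Bs : (A - l%:M)^T = A - l%:M by rewrite linearB /= tr_scalar_mx As.
have := projected_norm_ge0 Bs wE.
have BB : (A - l%:M) *m (A - l%:M) = A *m A - (2 * l) *: A + (l ^+ 2)%:M.
  rewrite mulmxBl !mulmxBr mul_scalar_mx !mul_mx_scalar.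
  rewrite mulr_natl mulr2n scalerDl.
  by rewrite !opprD opprK addrA scale_scalar_mx -expr2 addrA.
have -> : w^T *m (A - l%:M) *m w = w^T *m A *m w - l *: (w^T *m w).
  by rewrite mulmxBr mulmxBl mul_mx_scalar -scalemxAl.
have -> : w^T *m (A - l%:M) *m (A - l%:M) *m w =
   w^T *m A *m A *m w - (2 * l) *: (w^T *m A *m w) + (l ^+ 2) *: (w^T *m w).
  rewrite -(mulmxA w^T) BB mulmxDr mulmxBr mulmxDl mulmxBl mul_mx_scalar.
  by rewrite -scalemxAr -!scalemxAl !mulmxA.
rewrite BB.
rewrite !(mxtraceD, mxtraceN, mxtraceZ) wE mxtrace1 !mxtrace_scalar.
set t := \tr A; set h := \tr _; set q := \tr _; set H2 := \tr _.
(* This quadratic in l is minimal at l = k / (n - 1), where it equals Q - k^2 / (n - 1). *)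
rewrite (_ : _ + _ = Q - 2 * l * k + l ^+ 2 * (n%:R - 1)); last first.
  rewrite /Q /k -/t -/h -/q -/H2; ring.
have -> : k = l * (n%:R - 1) by rewrite /l; field; rewrite gt_eqF.
nra.
Qed.
End ProjectedHessian.

(** * Symmetry of mixed directional derivatives *)

Lemma dist_half_le (R : realType) (p q c e : R) :
  `|p - c| < e / 2 -> `|q - c| < e / 2 -> `|p - q| <= e.
Proof.
move=> pc qc; have := ltrD pc qc; rewrite -splitr => /ltW; apply: le_trans.
by apply: le_trans (ler_normB _ _); rewrite opprB addrA subrK.
Qed.

Section MixedDerivatives.
Variables (R : realType) (V : normedModType R).
Implicit Types (f : V -> R) (x v w : V).

Lemma is_derive_line f x v (s : R) : derivable f (x + s *: v) v ->
  is_derive s 1 (fun h => f (x + h *: v)) ('D_v f (x + s *: v)).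
Proof.
have E : (fun h => h^-1 *: (((fun k => f (x + k *: v)) \o shift s)
    (h *: (1:R)) - f (x + s *: v))) =
  (fun h => h^-1 *: ((f \o shift (x + s *: v)) (h *: v) - f (x + s *: v))).
  apply/funext => h /=; congr (_ *: (f _ - _)).
  by rewrite [h *: (1 : R)]mulr1 scalerDl addrCA.
by move=> fv; split; rewrite /derivable /derive E.
Qed.

Lemma MVT_line f x v (h : R) : 0 <= h ->
  (forall s : R, 0 <= s <= h -> derivable f (x + s *: v) v) ->
  exists2 s : R, 0 <= s <= h & f (x + h *: v) - f x = 'D_v f (x + s *: v) * h.
Proof.
move=> h0 fd.
have [| |s] := @MVT_segment R (fun s => f (x + s *: v))
  (fun s => 'D_v f (x + s *: v)) 0 h h0.
- move=> s; rewrite in_itv/= => /andP[/ltW s0 /ltW sh].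
  by apply/is_derive_line/fd; rewrite s0.
- apply: derivable_within_continuous => s.
  by rewrite in_itv/= => /fd/is_derive_line[].
- by rewrite in_itv/= scale0r addr0 subr0 => sh sE; exists s.
Qed.

(** The mean value theorem is used twice: along v for the increment y -> f (y + h w) - f y, then
    along w for the derivative of f along v. *)
Lemma second_difference f x v w (h : R) : 0 <= h ->
  (forall s t : R, 0 <= s <= h -> 0 <= t <= h ->
    derivable f (x + s *: v + t *: w) v /\
    derivable ('D_v f) (x + s *: v + t *: w) w) ->
  exists s t : R, [/\ 0 <= s <= h, 0 <= t <= h &
    f (x + h *: v + h *: w) - f (x + h *: v) - f (x + h *: w) + f x =
    'D_w ('D_v f) (x + s *: v + t *: w) * h ^+ 2].
Proof.
move=> h0 fd.
have hh : 0 <= h <= h by rewrite h0 lexx.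
have zh : 0 <= (0:R) <= h by rewrite h0 lexx.
pose g y := f (y + h *: w) - f y.
have D (s : R) : 0 <= s <= h ->
    is_derive (x + s *: v) v g
      ('D_v f (x + s *: v + h *: w) - 'D_v f (x + s *: v)).
  move=> sh; apply: is_deriveB; last first.
    by apply: derivableP; have [] := fd _ _ sh zh; rewrite scale0r addr0.
  have [d _] := fd _ _ sh hh.
  have E : (fun k => k^-1 *: (((fun y => f (y + h *: w)) \o shift (x + s *: v))
      (k *: v) - f (x + s *: v + h *: w))) =
    (fun k => k^-1 *: ((f \o shift (x + s *: v + h *: w)) (k *: v) -
      f (x + s *: v + h *: w))).
    by apply/funext => k /=; rewrite !addrA.
  by split; rewrite /derivable /derive E.
have [|s sh sE] := MVT_line (f := g) (x := x) (v := v) h0.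
  by move=> s /D[].
have [|t th tE] := MVT_line (f := 'D_v f) (x := x + s *: v) (v := w) h0.
  by move=> t th; have [] := fd _ _ sh th.
exists s, t; split => //.
have [_ DE] := D s sh.
by rewrite expr2 mulrA -tE -DE -sE /g; ring.
Qed.

(** The second difference is symmetric in v and w, so the two iterated derivatives agree at suitable
    intermediate points. These points lie arbitrarily close to x, and continuity there concludes. *)
Theorem mixed_derivative_comm f x v w :
  (\forall y \near x, [/\ derivable f y v, derivable f y w,
     derivable ('D_v f) y w & derivable ('D_w f) y v]) ->
  {for x, continuous ('D_w ('D_v f))} -> {for x, continuous ('D_v ('D_w f))} ->
  'D_w ('D_v f) x = 'D_v ('D_w f) x.
Proof.
move=> fd c1 c2; apply/eqP; rewrite -subr_eq0 -normr_le0; apply/ler_addgt0Pl.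
move=> e e0; rewrite addr0.
have e2 : 0 < e / 2 by rewrite divr_gt0.
move/cvgrPdist_lt : c1 => /(_ _ e2) c1.
move/cvgrPdist_lt : c2 => /(_ _ e2) c2.
have [r /= r0 rP] := (nbhs_ballP _ _).1 (filterI fd (filterI c1 c2)).
(* This size keeps the parallelogram spanned by h v and h w inside the ball; the summand 1 keeps the
   denominator positive when v = w = 0. *)
pose h := r / (2 * (1 + `|v| + `|w|)).
have N0 : 0 < 1 + `|v| + `|w| by rewrite -addrA ltr_pwDl// addr_ge0.
have h0 : 0 < h by rewrite divr_gt0// mulr_gt0.
have inr (s t : R) : 0 <= s <= h -> 0 <= t <= h ->
    ball x r (x + s *: v + t *: w).
  move=> /andP[s0 sh] /andP[t0 th]; rewrite -ball_normE/=.
  rewrite -addrA opprD addNKr normrN.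
  apply: le_lt_trans (ler_normD _ _) _; rewrite !normrZ !ger0_norm//.
  apply: (@le_lt_trans _ _ (h * (1 + `|v| + `|w|))).
    have := ler_wpM2r (normr_ge0 v) sh; have := ler_wpM2r (normr_ge0 w) th.
    lra.
  rewrite /h invfM mulrA divfK ?gt_eqF// ltr_pdivrMr// ltr_pMr//; lra.
have [|s1 [t1 [sh1 th1 E1]]] := @second_difference f x v w h (ltW h0).
  by move=> s t sh th; have [[]] := rP _ (inr s t sh th).
have [|s2 [t2 [sh2 th2 E2]]] := @second_difference f x w v h (ltW h0).
  move=> s t sh th; have -> : x + s *: w + t *: v = x + t *: v + s *: w.
    exact: addrAC.
  by have [[]] := rP _ (inr t s th sh).
have S : x + s2 *: w + t2 *: v = x + t2 *: v + s2 *: w by exact: addrAC.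
have Sh : f (x + h *: w + h *: v) = f (x + h *: v + h *: w).
  by congr f; exact: addrAC.
have [_ [+ _]] := rP _ (inr _ _ sh1 th1).
have [_ [_ +]] := rP _ (inr _ _ th2 sh2).
rewrite S {S} Sh {Sh} in E2.
have E : 'D_w ('D_v f) (x + s1 *: v + t1 *: w) =
    'D_v ('D_w f) (x + t2 *: v + s2 *: w).
  apply: (mulIf (x := h ^+ 2)); first by rewrite expf_neq0// gt_eqF.
  by apply: (etrans (esym E1)); apply: etrans E2; congr (_ + _); exact: addrAC.
by rewrite /= E; move=> C2 C1; exact: dist_half_le C1 C2.
Qed.

End MixedDerivatives.

(** * Consequences of C^k regularity *)

Section CkTheory.
Variables (R : realType) (n : nat).
Implicit Types (f : 'cV[R]_n -> R) (Omega : set 'cV[R]_n) (x : 'cV[R]_n).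

Lemma Ck_partial k Omega f i : Ck k.+1 Omega f -> Ck k Omega (partial i f).
Proof. by move=> [_ /(_ i)[]]. Qed.

Lemma Ck_derivable k Omega f i x : Ck k.+1 Omega f -> Omega x ->
  derivable f x (delta_mx i ord0).
Proof. by move=> [_ /(_ i)[+ _]]; exact. Qed.

Lemma Ck_continuous k Omega f x : Ck k Omega f -> Omega x ->
  {for x, continuous f}.
Proof. by case: k => [[]|k []] fc _; exact: fc. Qed.

Lemma CkS k Omega f : Ck k.+1 Omega f -> Ck k Omega f.
Proof.
elim: k f => [|k IH] f [fc fd]; split=> // i.
by have [fi /IH] := fd i.
Qed.

Lemma partial_comm Omega f i j x : open Omega -> Ck 2 Omega f -> Omega x ->
  partial i (partial j f) x = partial j (partial i f) x.
Proof.
move=> Oo f2 Ox; apply: mixed_derivative_comm.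
- near=> y; have Oy : Omega y by near: y; exact: open_nbhs_nbhs.
  split; [exact: (Ck_derivable f2 Oy) | exact: (Ck_derivable f2 Oy) |
          exact: (Ck_derivable (Ck_partial j f2) Oy) |
          exact: (Ck_derivable (Ck_partial i f2) Oy)].
- exact: (Ck_continuous (Ck_partial i (Ck_partial j f2)) Ox).
- exact: (Ck_continuous (Ck_partial j (Ck_partial i f2)) Ox).
Unshelve. all: by end_near. Qed.

End CkTheory.

(** * C^1 functions on the closed half-line *)

Section C1HalfLine.
Variables (R : realType) (a : R -> R).
Hypothesis a_C1 : C1_ge0 a.

(** For t > 0 the half-line is a neighbourhood of t, so the limit within it is an ordinary
    derivative. *)
Lemma C1_ge0_is_derive (t : R) : 0 < t -> is_derive t 1 a (derive_ge0 a t).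
Proof.
move=> t0; have [/(_ t (ltW t0)) acv _] := a_C1.
have {acv} :
  diffquot a t s @[s --> within `[0, +oo[ t^'] --> derive_ge0 a t by [].
set l := derive_ge0 a t => acv.
suff aP : h^-1 *: ((a \o shift t) (h *: (1:R)) - a t) @[h --> 0^'] --> l.
  by split; [apply/cvg_ex; exists l|exact: cvg_lim aP].
apply/cvgrPdist_lt => e e0.
have near_t : \forall s \near t, s != t -> `[0, +oo[%classic s ->
    `|l - diffquot a t s| < e.
  by move/cvgrPdist_lt : acv => /(_ _ e0); rewrite !near_withinE.
have [r /= r0 rP] := (nbhs_ballP _ _).1 near_t.
near=> h; have h0 : h != 0 by near: h; exact: nbhs_dnbhs_neq.
rewrite /= [h *: _]mulr1.
have := rP (h + t); rewrite /= /diffquot addrK [h^-1 *: _]mulrC; apply.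
- rewrite -ball_normE/= opprD addrCA subrr addr0 normrN.
  by near: h; exact: dnbhs0_lt.
- by rewrite -subr_eq0 addrK.
- rewrite in_itv/= andbT.
  have : `|h| < t by near: h; exact: dnbhs0_lt.
  by rewrite ltr_norml => /andP[h1 _]; rewrite -lerBlDr sub0r ltW.
Unshelve. all: by end_near. Qed.

(** One-sided continuity at 0, from a s = a 0 + q(s) s with q the difference quotient. This serves
    the points where Du vanishes. *)
Lemma C1_ge0_cvg0 : a s @[s --> within `[0, +oo[ (nbhs (0 : R))] --> a 0.
Proof.
have [/(_ 0 (lexx 0)) acv _] := a_C1.
have c : a s @[s --> within `[0, +oo[ (0 : R)^'] --> a 0.
  have -> : a = (fun s => a 0 + diffquot a 0 s * s).
    apply/funext => s; rewrite /diffquot subr0.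
    have [->|s0] := eqVneq s 0; first by rewrite mulr0 addr0.
    by rewrite divfK// addrC subrK.
  rewrite [X in _ --> X](_ : _ = a 0 + derive_ge0 a 0 * 0); last first.
    by rewrite !mulr0.
  apply: cvgD; first exact: cvg_cst.
  apply: cvgM; first exact: acv.
  have c0 : s @[s --> (0:R)^'] --> (0:R) by exact: cvg_within.
  exact: cvg_within_filter c0.
apply/cvgrPdist_lt => e e0; move/cvgrPdist_lt : c => /(_ _ e0).
rewrite !near_withinE; apply: filterS => s /= sP s0.
have [->|sn0] := eqVneq s 0; first by rewrite subrr normr0.
exact: sP.
Qed.

End C1HalfLine.

(** * Derivatives of products with a radial factor *)

Section RadialDerivative.
Variables (R : realType) (V : normedModType R).

Lemma is_derive_alongP (W : normedModType R) (f : V -> W) x v df :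
  is_derive x v f df <-> is_derive (0 : R) 1 (fun h : R => f (h *: v + x)) df.
Proof.
have E : (fun h : R => h^-1 *: ((f \o shift x) (h *: v) - f x)) =
    (fun h : R => h^-1 *: (((fun k : R => f (k *: v + x)) \o shift 0)
       (h *: (1:R)) - f ((0 : R) *: v + x))).
  by apply/funext => h /=; rewrite addr0 scale0r add0r [_%:A]mulr1.
by split=> -[] fd fE; split; move: fd fE; rewrite /derivable /derive E.
Qed.

(** Only a derivative along v is assumed of G, so the one-variable chain rule is applied on the line
    through x. *)
Lemma is_derive_comp_dir (f : R -> R) (G : V -> R) x v df dG :
  is_derive (G x) 1 f df -> is_derive x v G dG ->
  is_derive x v (fun y => f (G y)) (df * dG).
Proof.
move=> fd /is_derive_alongP Gd; apply/is_derive_alongP.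
by apply: (@is_derive1_comp R f (fun h : R => G (h *: v + x))); rewrite scale0r add0r.
Qed.

Variables (n : nat) (g : 'I_n -> V -> R) (x v : V) (dg : 'I_n -> R).
Hypothesis gd : forall k, is_derive x v (g k) (dg k).

Let N y := Num.sqrt (\sum_k g k y ^+ 2).

Lemma is_derive_sumsq :
  is_derive x v (fun y => \sum_k g k y ^+ 2) (2 * \sum_k g k x * dg k).
Proof.
have -> : (fun y => \sum_k g k y ^+ 2) = \sum_k (g k ^+ 2).
  by apply/funext => y; rewrite fct_sumE.
rewrite mulr_sumr; apply: is_derive_sum => k.
by apply: is_derive_eq; rewrite /= expr1; exact/esym/mulrA.
Qed.

Lemma is_derive_norm : N x != 0 ->
  is_derive x v N ((\sum_k g k x * dg k) / N x).
Proof.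
move=> Nx0; have S0 : 0 < \sum_k g k x ^+ 2.
  by rewrite -sqrtr_gt0 lt_def Nx0 sqrtr_ge0.
apply: is_derive_eq.
  exact: is_derive_comp_dir (is_derive1_sqrt S0) is_derive_sumsq.
by rewrite -/(N x); field.
Qed.

(** The sum of squares is differentiable along v and the square root is continuous everywhere, so
    zeros of N are covered, where [is_derive_norm] does not apply. *)
Lemma norm_line_cvg :
  N (h *: v + x) @[h --> (0:R)] --> N x.
Proof.
have /is_derive_alongP[d _] := is_derive_sumsq.
have c : {for (0:R), continuous (fun h : R => \sum_k g k (h *: v + x) ^+ 2)}.
  exact/differentiable_continuous/derivable1_diffP.
have -> : N x = N ((0 : R) *: v + x) by rewrite scale0r add0r.
exact: continuous_comp c (@sqrt_continuous R _).
Qed.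

(* Where N vanishes, a (N y) is only continuous at x, but F x = 0 makes the
   difference quotient of the product equal to a (N y) times that of F. *)
Lemma is_derive_radial (a : R -> R) (F : V -> R) (dF : R) :
  C1_ge0 a -> is_derive x v F dF -> (N x = 0 -> F x = 0) ->
  is_derive x v (fun y => a (N y) * F y)
    (a (N x) * dF + derive_ge0 a (N x) / N x * (\sum_k g k x * dg k) * F x).
Proof.
move=> aC Fd FN0; have [N0|N0] := eqVneq (N x) 0; last first.
  have Np : 0 < N x by rewrite lt_def N0 sqrtr_ge0.
  have Ad := is_derive_comp_dir (C1_ge0_is_derive aC Np) (is_derive_norm N0).
  have M := is_deriveM Ad Fd.
  refine (is_derive_eq (M : is_derive x v (fun y => a (N y) * F y) _) _).
  by rewrite /GRing.scale/=; field.
have F0 := FN0 N0; rewrite F0 mulr0 addr0 N0.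
suff aP :
  h^-1 *: (((fun y => a (N y) * F y) \o shift x) (h *: v) - a (N x) * F x)
    @[h --> (0:R)^'] --> a 0 * dF.
  by split; [apply/cvg_ex; exists (a 0 * dF)|exact: cvg_lim aP].
rewrite F0 mulr0.
have -> : (fun h : R =>
      h^-1 *: (((fun y => a (N y) * F y) \o shift x) (h *: v) - 0)) =
    (fun h : R =>
      a (N (h *: v + x)) * (h^-1 *: ((F \o shift x) (h *: v) - F x))).
  by apply/funext => h /=; rewrite F0 !subr0 [_ *: _]mulrCA.
apply: cvgM; last by have [d <-] := Fd; exact: d.
(* Values of N are square roots, hence N tends to 0 within the half-line and one-sided continuity of
   a suffices. *)
apply: (@cvg_comp _ _ _ (fun h : R => N (h *: v + x)) a _
  (within `[0, +oo[ (nbhs (0 : R))));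
  last exact: C1_ge0_cvg0.
apply: cvg_within_filter.
have Nc := norm_line_cvg; rewrite N0 in Nc.
move=> P PN.
have : \forall h \near (0 : R), `[0, +oo[%classic (N (h *: v + x)) ->
  P (N (h *: v + x)) := Nc _ PN.
by apply: filterS => h; apply; rewrite /= in_itv/= andbT; exact: sqrtr_ge0.
Qed.

End RadialDerivative.

(** * Jacobians and divergences of the fields built from Du *)

Section VectorFields.
Variables (R : realType) (n : nat).
Implicit Types (u : 'cV[R]_n -> R) (a b : R -> R) (x y : 'cV[R]_n)
  (X Y : 'cV[R]_n -> 'cV[R]_n) (Omega : set 'cV[R]_n).

(** Indexed as the Jacobian of [grad u]; its symmetry is the separate fact [hessian_sym]. *)
Definition hessian u x : 'M[R]_n := \matrix_(i, j) partial j (partial i u) x.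

Lemma hsnorm_sqr m p (M : 'M[R]_(m, p)) : hsnorm M ^+ 2 = \tr (M *m M^T).
Proof.
rewrite tr_mxsq_sum sqr_sqrtr//.
by do 2![apply: sumr_ge0 => ? _]; exact: sqr_ge0.
Qed.

Lemma hsnorm_eq0 m p (M : 'M[R]_(m, p)) : hsnorm M = 0 -> M = 0.
Proof.
move=> M0; apply/matrixP => i j; rewrite mxE; apply/eqP; rewrite -sqrf_eq0.
have : \sum_i \sum_j M i j ^+ 2 == 0.
  by rewrite -tr_mxsq_sum -hsnorm_sqr M0 expr0n.
rewrite psumr_eq0 => [/allP/(_ i (mem_index_enum _))/=|k _]; last first.
  by apply: sumr_ge0 => ? _; exact: sqr_ge0.
rewrite psumr_eq0 => [/allP/(_ j (mem_index_enum _))//|k _]; exact: sqr_ge0.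
Qed.

Lemma hsnorm_gradE u :
  (fun y => hsnorm (grad u y)) =
  (fun y => Num.sqrt (\sum_k partial k u y ^+ 2)).
Proof.
apply/funext => y; congr Num.sqrt; apply: eq_bigr => k _.
by rewrite big_ord1 mxE.
Qed.

Lemma divergence_tr X x : divergence X x = \tr (jac X x).
Proof. by apply: eq_bigr => i _; rewrite mxE. Qed.

Lemma eq_divergence X Y x : (\forall y \near x, X y = Y y) ->
  divergence X x = divergence Y x.
Proof.
move=> XY; apply: eq_bigr => i _; apply: near_eq_derive.
by apply: filterS XY => y ->.
Qed.

Lemma hessian_sym Omega u x : open Omega -> Ck 2 Omega u -> Omega x ->
  (hessian u x)^T = hessian u x.
Proof.
move=> Oo uC Ox; apply/matrixP => i j.
by rewrite !mxE (partial_comm _ _ Oo uC Ox).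
Qed.

Lemma is_derive_partial k Omega u i x : Ck k.+1 Omega u -> Omega x ->
  is_derive x (delta_mx i ord0) u (partial i u x).
Proof. by move=> uC Ox; apply: derivableP; exact: Ck_derivable uC Ox. Qed.

Lemma is_derive_radial_grad Omega u a (F : 'cV[R]_n -> R) dF j x :
  open Omega -> Ck 2 Omega u -> Omega x -> C1_ge0 a ->
  is_derive x (delta_mx j ord0) F dF -> (grad u x = 0 -> F x = 0) ->
  is_derive x (delta_mx j ord0) (fun y => a (hsnorm (grad u y)) * F y)
    (a (hsnorm (grad u x)) * dF
     + derive_ge0 a (hsnorm (grad u x)) / hsnorm (grad u x)
       * (hessian u x *m grad u x) j ord0 * F x).
Proof.
move=> Oo uC Ox aC Fd F0.
have gd k :
    is_derive x (delta_mx j ord0) (partial k u) (partial j (partial k u) x).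
  exact: is_derive_partial (Ck_partial k uC) Ox.
have NE y : hsnorm (grad u y) = Num.sqrt (\sum_k partial k u y ^+ 2).
  by have /(congr1 (@^~ y)) := hsnorm_gradE u.
have -> : (fun y => a (hsnorm (grad u y)) * F y) =
    (fun y => a (Num.sqrt (\sum_k partial k u y ^+ 2)) * F y).
  by apply/funext => y; rewrite NE.
have -> : (hessian u x *m grad u x) j ord0 =
    \sum_k partial k u x * partial j (partial k u) x.
  rewrite mxE; apply: eq_bigr => k _.
  by rewrite !mxE mulrC (partial_comm _ _ Oo uC Ox).
rewrite NE; apply: is_derive_radial => // N0.
by apply/F0/hsnorm_eq0; rewrite NE.
Qed.

(** Product rule, with D|Du| = H Du / |Du|. At a critical point the rank-one term vanishes with its
    factor [grad u x], leaving a(0) H. *)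
Lemma jac_Vfield Omega u a x :
  open Omega -> Ck 2 Omega u -> Omega x -> C1_ge0 a ->
  jac (Vfield a u) x = a (hsnorm (grad u x)) *: hessian u x
    + (derive_ge0 a (hsnorm (grad u x)) / hsnorm (grad u x))
      *: (grad u x *m (hessian u x *m grad u x)^T).
Proof.
move=> Oo uC Ox aC; apply/matrixP => i j; rewrite [LHS]mxE.
have -> : (fun y => Vfield a u y i ord0) =
    (fun y => a (hsnorm (grad u y)) * partial i u y).
  by apply/funext => y; rewrite /Vfield mxE [grad u y i ord0]mxE.
have Fd := is_derive_partial j (Ck_partial i uC) Ox.
have [|_] := is_derive_radial_grad Oo uC Ox aC Fd.
  by move=> /matrixP/(_ i ord0); rewrite !mxE.
rewrite /partial => ->.
rewrite [RHS]mxE [X in _ = X + _]mxE [X in _ = _ + X]mxE.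
rewrite [hessian u x i j]mxE -mulrA; congr (_ + _ * _).
by rewrite [RHS]mxE big_ord1 [_^T _ _]mxE [grad u x i _]mxE mulrC.
Qed.

(* The terms with b' cancel; since b is only C^1, this is what makes the
   divergence of the field exist. *)
Lemma reduced_fieldE Omega u b x :
  open Omega -> Ck 2 Omega u -> Omega x -> C1_ge0 b ->
  (jac (Vfield b u) x - \tr (jac (Vfield b u) x) *: 1%:M) *m Vfield b u x =
  b (hsnorm (grad u x)) ^+ 2
    *: (hessian u x *m grad u x - \tr (hessian u x) *: grad u x).
Proof.
move=> Oo uC Ox bC; rewrite (jac_Vfield Oo uC Ox bC) /Vfield.
have Hs := hessian_sym Oo uC Ox.
set H := hessian u x in Hs *; set p := grad u x; set t := b _; set k := _ / _.
rewrite trmx_mul Hs mulmxBl -scalemxAl mul1mx mulmxDl -!scalemxAl.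
rewrite -scalemxAr -[p *m _ *m _]mulmxA -(scalemxAr t (p^T *m H)).
(* Once p^T H p is a scalar h, the Jacobian and its trace both contribute k t h p, with opposite
   signs. *)
have -> : p^T *m H *m p = (\tr (p^T *m H *m p))%:M.
  by rewrite trace_mx11 -mx11_scalar.
set h := \tr (p^T *m H *m p).
rewrite linearD/= !linearZ/= [\tr (p *m _)]mxtrace_mulC -/h.
rewrite mul_mx_scalar; apply/matrixP => i j; rewrite !mxE; ring.
Qed.

(** Here [d1], [d2], [d3] stand for the derivatives of u of orders 1, 2, 3 at a point. Exchanging
    the sums and using the symmetry of [d3] identifies the two third-order sums, which cancel. *)
Lemma divergence_cancellation (d1 : 'I_n -> R) (d2 : 'I_n -> 'I_n -> R)
    (d3 : 'I_n -> 'I_n -> 'I_n -> R) :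
  (forall i j k, d3 i j k = d3 j i k) ->
  \sum_i (\sum_j (d2 j i * d2 i j + d1 j * d3 i j i)
          - ((\sum_j d2 j j) * d2 i i + d1 i * (\sum_j d3 i j j))) =
  \sum_i \sum_j d2 j i * d2 i j - (\sum_i d2 i i) ^+ 2.
Proof.
move=> d3C; rewrite sumrB; under eq_bigr do rewrite big_split/=.
rewrite !big_split/=.
have -> : \sum_i \sum_j d1 j * d3 i j i = \sum_i d1 i * (\sum_j d3 i j j).
  rewrite exchange_big; apply: eq_bigr => i _; rewrite mulr_sumr.
  by apply: eq_bigr => j _; rewrite d3C.
by rewrite -mulr_sumr opprD addrACA subrr addr0 expr2.
Qed.

(** The derivatives of the components are exposed, besides their sum, because the product rule for
    b^2 G is applied to each component. *)
Lemma divergence_hessian_field Omega u x :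
  open Omega -> Ck 3 Omega u -> Omega x ->
  exists2 dG : 'I_n -> R,
    forall i, is_derive x (delta_mx i ord0)
      (fun y => (hessian u y *m grad u y
                 - \tr (hessian u y) *: grad u y) i ord0) (dG i) &
    \sum_i dG i = \tr (hessian u x *m hessian u x) - \tr (hessian u x) ^+ 2.
Proof.
move=> Oo uC Ox.
have uD j k := is_derive_partial k (Ck_partial j uC) Ox.
have HD i j k := is_derive_partial k (Ck_partial j (Ck_partial i uC)) Ox.
pose T y := \sum_j partial j (partial j u) y.
have TD i : is_derive x (delta_mx i ord0) T
    (\sum_j partial i (partial j (partial j u)) x).
  have -> : T = \sum_j partial j (partial j u).
    by apply/funext => y; rewrite fct_sumE.
  exact: is_derive_sum.
have TE : T x = \tr (hessian u x) by apply: eq_bigr => j _; rewrite mxE.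
exists (fun i => \sum_j (partial j (partial i u) x * partial i (partial j u) x +
     partial j u x * partial i (partial j (partial i u)) x)
   - (T x * partial i (partial i u) x
      + partial i u x * (\sum_j partial i (partial j (partial j u)) x))).
  move=> i.
  have -> : (fun y => (hessian u y *m grad u y
      - \tr (hessian u y) *: grad u y) i ord0) =
    \sum_j (partial j (partial i u) * partial j u) - T * partial i u.
    apply/funext => y; rewrite !mxE; congr (_ - _).
      by rewrite fct_sumE; apply: eq_bigr => j _; rewrite !mxE.
    by congr (_ * _); apply: eq_bigr => j _; rewrite mxE.
  have DS := is_derive_sum (fun j => is_deriveM (HD i j i) (uD j i)).
  exact: (is_deriveB DS (is_deriveM (TD i) (uD i i))).
have d3C i j k : partial i (partial j (partial k u)) x =
    partial j (partial i (partial k u)) x.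
  exact: partial_comm Oo (Ck_partial k uC) Ox.
rewrite [LHS](divergence_cancellation (fun j => partial j u x)
  (fun i j => partial i (partial j u) x) d3C).
rewrite [\sum_i partial i _ _]TE; congr (_ - _).
by apply: eq_bigr => i _; rewrite mxE; apply: eq_bigr => j _; rewrite !mxE.
Qed.

Lemma divergence_reduced_field Omega u b x :
  open Omega -> Ck 3 Omega u -> Omega x -> C1_ge0 b ->
  let p := grad u x in let H := hessian u x in
  let t := b (hsnorm p) in let k := derive_ge0 b (hsnorm p) / hsnorm p in
  divergence (fun y => (jac (Vfield b u) y - \tr (jac (Vfield b u) y) *: 1%:M)
                         *m Vfield b u y) x =
  t ^+ 2 * (\tr (H *m H) - \tr H ^+ 2)
  + 2 * t * k * (\tr (p^T *m H *m H *m p) - \tr H * \tr (p^T *m H *m p)).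
Proof.
move=> Oo uC Ox bC p H t k; have uC2 := CkS uC.
have [dG GD sumdG] := divergence_hessian_field Oo uC Ox.
pose G y := hessian u y *m grad u y - \tr (hessian u y) *: grad u y.
(* Divergence is local and Omega is open, so the reduced form of the field may be differentiated
   instead. *)
rewrite (@eq_divergence _ (fun y => b (hsnorm (grad u y)) ^+ 2 *: G y));
  last first.
  near=> y; rewrite (@reduced_fieldE Omega)//.
  by near: y; exact: open_nbhs_nbhs.
have G0 i : p = 0 -> G x i ord0 = 0.
  by rewrite /G -/p => ->; rewrite mulmx0 scaler0 subr0 mxE.
rewrite /divergence (eq_bigr (fun i =>
  t ^+ 2 * dG i + 2 * t * k * ((H *m p) i ord0 * G x i ord0))).
  rewrite big_split/= -!mulr_sumr sumdG; congr (_ + _ * _).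
  (* The remaining sum is the inner product of H p and G x, rewritten as a trace. *)
  have Hs := hessian_sym Oo uC2 Ox.
  transitivity (\tr (G x *m (H *m p)^T)).
    by apply: eq_bigr => i _; rewrite !mxE big_ord1 !mxE mulrC.
  rewrite mxtrace_mulC trmx_mul Hs mulmxBr linearB/= -scalemxAr linearZ/=.
  by rewrite !mulmxA.
move=> i _.
(* The field is treated as b (b G): the radial rule is used twice, and is valid at critical points
   because G and b G vanish there. *)
have D1 := is_derive_radial_grad Oo uC2 Ox bC (GD i) (G0 i).
have [|_ D2] := is_derive_radial_grad Oo uC2 Ox bC D1.
  by move=> p0; rewrite G0// mulr0.
have -> : (fun y => (b (hsnorm (grad u y)) ^+ 2 *: G y) i ord0) =
  (fun y => b (hsnorm (grad u y)) * (b (hsnorm (grad u y)) * G y i ord0)).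
  by apply/funext => y; rewrite mxE expr2 mulrA.
rewrite /partial D2 -/p -/H -/t -/k -/(G x); ring.
Unshelve. all: by end_near. Qed.

End VectorFields.

(** * From extended-real bounds to real inequalities *)

Section Bounds.
Variable R : realType.
Implicit Types f : R -> R.

Lemma inf_ge0_le f t :
  inf_ge0 f \is a fin_num -> 0 <= t -> fine (inf_ge0 f) <= f t.
Proof.
move=> ffin t0; rewrite -lee_fin fineK//; apply: ereal_inf_lbound.
by exists t => //=; rewrite in_itv/= t0.
Qed.

Lemma le_sup_ge0 f t :
  sup_ge0 f \is a fin_num -> 0 <= t -> f t <= fine (sup_ge0 f).
Proof.
move=> ffin t0; rewrite -lee_fin fineK//; apply: ereal_sup_ubound.
by exists t => //=; rewrite in_itv/= t0.
Qed.

(** For n = 2 the factor n - 2 is zero and the claim is 0 < 2, which matches the infinite bound;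
    otherwise denominators are cleared. *)
Lemma theta_bound_lt n (s : \bar R) : (2 <= n)%N -> s \is a fin_num ->
  (s < theta_bound R n)%E ->
  ((n%:R - 1) - 1) / (n%:R - 1) * fine s < 2.
Proof.
move=> n2 sfin; have n1 : 0 < n%:R - 1 :> R by rewrite subr_gt0 ltr1n.
have -> : n%:R - 1 - 1 = n%:R - 2 :> R by rewrite -addrA -opprD.
rewrite /theta_bound; have [->|nn2] := eqVneq n 2%N.
  by rewrite subrr !mul0r.
have n20 : 0 < n%:R - 2 :> R by rewrite subr_gt0 ltr_nat ltn_neqAle eq_sym nn2.
rewrite -{1}(fineK sfin) lte_fin ltr_pdivlMr// => h.
by rewrite mulrAC ltr_pdivrMr// mulrC.
Qed.

Lemma between_fin_num (r : R) (i s t : \bar R) :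
  (r%:E < i)%E -> (i <= s)%E -> (s < t)%E ->
  (i \is a fin_num) * (s \is a fin_num).
Proof.
move=> ri ls st.
have sy : (s < +oo)%E by exact: lt_le_trans st (leey t).
have iNy : (-oo < i)%E by exact: lt_trans (ltNyr r) ri.
by rewrite !fin_numElt iNy (le_lt_trans ls sy) (lt_le_trans iNy ls).
Qed.

End Bounds.

(** * The pointwise estimate *)

Lemma grad_direction (R : realType) (n : nat) (p : 'cV[R]_n) : (0 < n)%N ->
  exists2 w : 'cV[R]_n, w^T *m w = 1%:M & p = hsnorm p *: w.
Proof.
case: n p => // n p _.
have [p0|p0] := eqVneq (hsnorm p) 0.
  (* Any unit vector serves at p = 0; the first basis vector exists since the dimension is
     positive. *)
  exists (delta_mx ord0 ord0); last by rewrite p0 scale0r; exact: hsnorm_eq0.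
  by rewrite trmx_delta mul_delta_mx; apply/matrixP => i j; rewrite !ord1 !mxE.
exists ((hsnorm p)^-1 *: p); last by rewrite scalerA divff// scale1r.
rewrite [X in X *m _]linearZ/= -scalemxAl -scalemxAr scalerA -invfM -expr2.
rewrite hsnorm_sqr mxtrace_mulC [X in _ *: X]mx11_scalar scale_scalar_mx.
rewrite -trace_mx11 mulVf//.
by rewrite mxtrace_mulC -hsnorm_sqr expf_neq0.
Qed.

Theorem lemma3p2 (R : realType) (n : nat) (hn : (2 <= n)%N) :
  exists (c : \bar R -> \bar R -> \bar R -> \bar R -> R)
         (C : \bar R -> \bar R -> R),
  forall (Omega : set 'cV[R]_n) (u : 'cV[R]_n -> R) (a b : R -> R),
    domain Omega ->
    Ck 3 Omega u ->
    (forall t : R, 0 <= t -> 0 < a t) -> C1_ge0 a ->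
    (forall t : R, 0 <= t -> 0 < b t) -> C1_ge0 b ->
    let i_a := inf_ge0 (vartheta a) in
    let s_a := sup_ge0 (vartheta a) in
    let i_b := inf_ge0 (vartheta b) in
    let s_b := sup_ge0 (vartheta b) in
    let i_th := inf_ge0 (theta a b) in
    let s_th := sup_ge0 (theta a b) in
    ((-1)%:E < i_a)%E -> (i_a <= s_a)%E -> (s_a < +oo)%E ->
    ((-1)%:E < i_b)%E -> (i_b <= s_b)%E -> (s_b < +oo)%E ->
    (0%:E < i_th)%E -> (i_th <= s_th)%E -> (s_th < theta_bound R n)%E ->
    let Va := Vfield a u in
    let Vb := Vfield b u in
    0 < c i_th s_th i_b s_b /\ 0 < C i_th s_th /\
    forall x, Omega x ->
      c i_th s_th i_b s_b * hsnorm (jac Vb x) ^+ 2 <=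
        divergence
          (fun y => (jac Vb y - \tr (jac Vb y) *: 1%:M) *m Vb y) x
        + C i_th s_th *
          (b (hsnorm (grad u x)) / a (hsnorm (grad u x))) ^+ 2
          * divergence Va x ^+ 2.
Proof.
(* The parameter m = n - 1 is the dimension of the hyperplane orthogonal to w. The hypotheses make
   all four bounds finite, so [fine] returns their true values. *)
exists (fun it st ib sb =>
  const_c (n%:R - 1) (fine it) (fine st) (fine ib) (fine sb)).
exists (fun it st => const_C (n%:R - 1) (fine it) (fine st)).
move=> Omega u a b [Oo _ _] uC a_gt0 aC b_gt0 bC.
move=> i_a s_a i_b s_b i_th s_th _ _ _.
move=> ib_gt ib_le sb_lt it_gt it_le st_lt Va Vb.
have [ib_fin sb_fin] := between_fin_num ib_gt ib_le sb_lt.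
have [it_fin st_fin] := between_fin_num it_gt it_le st_lt.
have ib_gt0 : 0 < 1 + fine i_b.
  by move: ib_gt; rewrite -{1}(fineK ib_fin) lte_fin -subr_gt0 opprK addrC.
have it_gt0 : 0 < fine i_th by move: it_gt; rewrite -{1}(fineK it_fin) lte_fin.
have st_bd := theta_bound_lt hn st_fin st_lt.
have m_ge1 : 1 <= n%:R - 1 :> R.
  by have : 2 <= n%:R :> R by [rewrite ler_nat]; lra.
split; first exact: const_c_gt0.
split; first exact: const_C_gt0.
move=> x Ox; have uC2 := CkS uC.
rewrite (divergence_reduced_field Oo uC Ox bC) divergence_tr hsnorm_sqr.
rewrite !(jac_Vfield Oo uC2 Ox)//.
have Hs := hessian_sym Oo uC2 Ox.
have [w w1 pE] := grad_direction (grad u x) (ltnW hn).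
set t := hsnorm _ in pE *; have t_ge0 : 0 <= t by exact: sqrtr_ge0.
set H := hessian u x in Hs *.
(* This turns k t^2 into f(t) times the logarithmic derivative. At t = 0 both sides are 0, so
   critical points need no separate case below. *)
have logder f : 0 < f t -> derive_ge0 f t / t * t ^+ 2 = f t * vartheta f t.
  move=> ft; rewrite /vartheta; have [->|t0] := eqVneq t 0.
    by rewrite expr0n !(mul0r, mulr0).
  by field; rewrite t0 gt_eqF.
have kaE := logder a (a_gt0 t t_ge0); have kbE := logder b (b_gt0 t t_ge0).
have at0 := a_gt0 t t_ge0; have bt0 := b_gt0 t t_ge0.
have := @invariants_ineq R (n%:R - 1)
  (fine i_th) (fine s_th) (fine i_b) (fine s_b)
  (vartheta a t) (vartheta b t) (\tr (w^T *m H *m w)) (\tr (w^T *m H *m H *m w))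
  (\tr (H *m H)) (\tr H) m_ge1 it_gt0 st_bd ib_gt0
  (inf_ge0_le ib_fin t_ge0) (le_sup_ge0 sb_fin t_ge0)
  (inf_ge0_le it_fin t_ge0) (le_sup_ge0 st_fin t_ge0)
  (quadform_sqr_le Hs w1) (projected_trace_le hn Hs w1).
rewrite pE; move: kaE kbE; set ka := _ / t; set kb := derive_ge0 b t / t.
move=> kaE kbE.
have twE : (t *: w)^T = t *: w^T by rewrite linearZ.
have h_scale : \tr ((t *: w)^T *m H *m (t *: w)) = t ^+ 2 * \tr (w^T *m H *m w).
  by rewrite twE -!scalemxAl -scalemxAr scalerA linearZ/= -expr2.
have w2_scale : \tr ((t *: w)^T *m H *m H *m (t *: w)) =
    t ^+ 2 * \tr (w^T *m H *m H *m w).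
  by rewrite twE -!scalemxAl -scalemxAr scalerA linearZ/= -expr2.
have -> : t *: w *m (H *m (t *: w))^T = t ^+ 2 *: (w *m (w^T *m H)).
  by rewrite trmx_mul Hs twE -!scalemxAl -scalemxAr scalerA -expr2.
rewrite h_scale w2_scale !scalerA kaE kbE.
set h := \tr (w^T *m H *m w); set w2 := \tr (w^T *m H *m H *m w).
set H2 := \tr (H *m H).
(* B is the rank-one matrix w (H w)^T: its trace is w.Hw, and its products with H, H and itself all
   have trace |H w|^2. *)
set B := w *m (w^T *m H).
have trB : \tr B = h by rewrite mxtrace_mulC.
have trHB : \tr (H *m B^T) = w2.
  by rewrite /B !trmx_mul trmxK Hs !mulmxA mxtrace_mulC !mulmxA.
have trBB : \tr (B *m B^T) = w2.
  by rewrite /B !trmx_mul trmxK Hs !mulmxA mxtrace_mulC !mulmxA w1 mul1mx.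
have trBH : \tr (B *m H) = w2 by rewrite /B -mulmxA mxtrace_mulC.
set va := vartheta a t in kaE *; set vb := vartheta b t in kbE *.
have jacE :
    \tr ((b t *: H + (b t * vb) *: B) *m (b t *: H + (b t * vb) *: B)^T) =
    b t ^+ 2 * (H2 + (2 * vb + vb ^+ 2) * w2).
  have -> : (b t *: H + (b t * vb) *: B)^T = b t *: H + (b t * vb) *: B^T.
    by rewrite linearD/=; congr (_ + _); rewrite linearZ/= ?Hs.
  rewrite mulmxDl !mulmxDr -!scalemxAl -!scalemxAr !mxtraceD !mxtraceZ.
  by rewrite -/H2 trHB trBB trBH; ring.
have divE : \tr (a t *: H + (a t * va) *: B) = a t * (\tr H + va * h).
  by rewrite mxtraceD !mxtraceZ trB; ring.
rewrite jacE divE => /(ler_wpM2l (sqr_ge0 (b t))).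
set c := const_c _ _ _ _ _; set C := const_C _ _ _.
have -> : b t ^+ 2 * (c * (H2 + (2 * vb + vb ^+ 2) * w2)) =
  c * (b t ^+ 2 * (H2 + (2 * vb + vb ^+ 2) * w2)) by rewrite mulrCA.
(* What remains is an equality: the factor (b / a)^2 turns the a^2 of (div V_a)^2 into b^2. *)
move=> /le_trans; apply; rewrite le_eqVlt; apply/orP; left; apply/eqP.
have -> : 2 * b t * kb * (t ^+ 2 * w2 - \tr H * (t ^+ 2 * h)) =
    2 * b t * (kb * t ^+ 2) * (w2 - \tr H * h) by ring.
by rewrite kbE; field; rewrite gt_eqF.
Qed.
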